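(* (i) There exist discrete probability measures $\mu_f,\mu_g$ supported on a bounded, countably infinite subset of $[0,\infty)$, with probability mass functions $f,g$ and cumulative distribution functions $F,G$, respectively, such that $\mu_f\preceq\mu_g$, the probability mass functions $f,g$ alternate, and the cumulative distribution functions $F,G$ alternate. (ii) There exist absolutely continuous probability measures $\mu_{\tilde f},\mu_{\tilde g}$ supported on a compact subset of $[0,\infty)$, with probability density functions $\tilde f,\tilde g$ and cumulative distribution functions $\tilde F,\tilde G$, respectively, such that $\mu_{\tilde f}\preceq\mu_{\tilde g}$, the densities $\tilde f,\tilde g$ alternate, the cumulative distribution functions $\tilde F,\tilde G$ alternate, and $\tilde f,\tilde g$ are continuous.
   Context: $\mathbb{N}$ is the set of natural numbers including $0$. For a finite positive Borel measure $\mu$ on $[0,\infty)$ all of whose moments $s_n(\mu)=\int_0^\infty t^n\,d\mu(t)$, $n\in\mathbb{N}$, exist, the tail relation is defined by: $\mu_1\preceq\mu_2$ if and only if there is $n_0\in\mathbb{N}$ such that $s_n(\mu_1)\le s_n(\mu_2)$ for all $n\ge n_0$. Two real functions $u,v$ associated with a pair of compactly supported measures are said to alternate if neither eventually dominates the other at the right end of the support: with $\beta$ the maximum of the union of the supports of the two measures, there is a strictly increasing sequence $(z_k)_{k\ge1}$ of real numbers converging to $\beta$ such that $u(z_k)>v(z_k)$ for all odd $k$ and $u(z_k)<v(z_k)$ for all even $k$. *)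

(* Defs.v *)
From HB Require Import structures.
From mathcomp Require Import all_boot all_order all_algebra.
From mathcomp Require Import all_classical all_reals all_analysis.

Set Implicit Arguments.
Unset Strict Implicit.
Unset Printing Implicit Defensive.
Import Order.TTheory GRing.Theory Num.Theory.
Import numFieldNormedType.Exports.
Local Open Scope classical_set_scope.
Local Open Scope ring_scope.

(** Borel measures on [0, +oo[ are represented as Borel measures on [R] that
    give no mass to the complement of [0, +oo[. *)

Definition carried_by (R : realType) (mu : {measure set (measurableTypeR R) -> \bar R})
  (S : set (measurableTypeR R)) : Prop := measurable S /\ mu (~` S) = 0%E.

Definition has_moments (R : realType) (mu : {measure set (measurableTypeR R) -> \bar R}) : Prop :=
  forall n : nat, mu.-integrable `[0, +oo[ (fun t => (t ^+ n)%:E).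

Definition moment (R : realType) (mu : {measure set (measurableTypeR R) -> \bar R}) (n : nat) :
  \bar R := (\int[mu]_(t in `[0%R, +oo[) (t ^+ n)%:E)%E.

Definition tail_domain (R : realType) (mu : {measure set (measurableTypeR R) -> \bar R}) : Prop :=
  carried_by mu `[0, +oo[ /\ has_moments mu.

(** Finiteness of the measure is the case [n = 0] of [has_moments]. *)
Definition tail_le (R : realType) (mu1 mu2 : {measure set (measurableTypeR R) -> \bar R}) : Prop :=
  [/\ tail_domain mu1, tail_domain mu2 &
      exists n0 : nat, forall n : nat, (n0 <= n)%N ->
        (moment mu1 n <= moment mu2 n)%E].

Definition measure_support (R : realType) (mu : {measure set (measurableTypeR R) -> \bar R}) :
  set R := [set x | forall U : set R, open U -> U x -> (0 < mu U)%E].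

(** The sequence [z] is indexed from 1; [z 0] is irrelevant. *)
Definition alternate (R : realType) (mu1 mu2 : {measure set (measurableTypeR R) -> \bar R})
    (u v : R -> R) : Prop :=
  exists beta : R,
    [/\ (measure_support mu1 `|` measure_support mu2) beta,
        ubound (measure_support mu1 `|` measure_support mu2) beta &
        exists z : nat -> R,
          [/\ forall j k : nat, (0 < j < k)%N -> z j < z k,
              z @ \oo --> beta,
              forall k : nat, (0 < k)%N -> odd k -> u (z k) > v (z k) &
              forall k : nat, (0 < k)%N -> ~~ odd k -> u (z k) < v (z k)]].

(** The mass function and the distribution function of a law on [R] are those
    of the identity random variable on the probability space [(R, mu)]. *)
Definition idRV (R : realType) : measurableTypeR R -> R := idfun.

HB.instance Definition _ (R : realType) :=
  @isMeasurableFun.Build _ _ _ _ (@idRV R) (@measurable_id _ _ setT).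

Definition law_pmf (R : realType) (mu : probability (measurableTypeR R) R)
  (x : R) : R := pmf (@idRV R : {RV mu >-> R}) x.

Definition law_cdf (R : realType) (mu : probability (measurableTypeR R) R)
  (x : R) : R := fine (cdf (@idRV R : {RV mu >-> R}) x).

Definition is_density (R : realType) (mu : probability (measurableTypeR R) R)
  (f : R -> R) : Prop :=
  [/\ measurable_fun [set: measurableTypeR R] f,
      forall x, 0 <= f x &
      forall A : set (measurableTypeR R), measurable A ->
        mu A = (\int[lebesgue_measure]_(x in A) (f x)%:E)%E].

(* Main.v *)
Require Import Defs.
From HB Require Import structures.
From mathcomp Require Import all_boot all_order all_algebra.
From mathcomp Require Import all_classical all_reals all_analysis.
From mathcomp Require Import measurable_realfun ring lra.

Set Implicit Arguments.
Unset Strict Implicit.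
Unset Printing Implicit Defensive.
Import Order.TTheory GRing.Theory Num.Theory.
Import numFieldNormedType.Exports.
Local Open Scope classical_set_scope.
Local Open Scope ring_scope.

(** Both parts rest on the convex order. Every power t^n is convex on
    [0, +oo[, so spreading mass around its barycentre increases all moments
    at once, while the distribution function goes up to the left of the
    barycentre and down to its right. Doing this infinitely often, closer and
    closer to 1, orders the moments but makes masses (or densities) and
    distribution functions cross infinitely often near 1.

    In the discrete case the k-th atom of the first law, of mass 2^-(k+1), sits
    at [mid_atom k]; the second law replaces it by two atoms [left_atom k] and
    [right_atom k] with the same barycentre. These blocks are separated from
    one another, so at a point of block k only the k-th terms of the two laws
    differ ([mixture_lt]). At the middle atom the first law has both more mass
    and the larger distribution function; at the left atom the second one has.

    In the continuous case the difference of the densities is a multiple of a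
    second derivative k0'', where k0 >= 0 vanishes with its first two
    derivatives at 0 and 1. The difference of the distribution functions is
    then the same multiple of k0', and two integrations by parts turn the
    difference of the n-th moments into a multiple of the integral of
    n (n - 1) t^(n-2) k0 >= 0. For the densities themselves one can take the
    negative and the positive part of k0'', normalised: they have the same
    mass because k0'' has integral zero. This is
    [second_derivative_density_pair]. It is applied to
    k0 x = (1 - x)^5 sin (pi / (1 - x))^4, whose first and second derivatives
    change sign infinitely often near 1, the power of 1 - x being large enough
    to keep them continuous at 1. *)

(** * Alternation, supports and moments *)

Definition interlace (R : realType) (p q : nat -> R) (j : nat) : R :=
  if odd j then q j./2 else p j./2.

Lemma interlace_lt (R : realType) (p q : nat -> R) :
  (forall k, p k < q k) -> (forall k, q k < p k.+1) ->
  {homo interlace p q : i j / (i < j)%N >-> i < j}.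
Proof.
move=> pq qp; apply: homo_ltn => [y x z|i]; first exact: lt_trans.
rewrite /interlace /= uphalf_half; by case: (odd i); rewrite /= ?add0n.
Qed.

Lemma cvg_interlace (R : realType) (p q : nat -> R) (l : R) :
  p @ \oo --> l -> q @ \oo --> l -> interlace p q @ \oo --> l.
Proof.
move=> /cvgrPdist_lt pl /cvgrPdist_lt ql; apply/cvgrPdist_lt => e e0.
have [N1 _ pN] := pl _ e0; have [N2 _ qN] := ql _ e0.
exists (maxn N1 N2).*2 => // j /=.
rewrite -geq_half_double geq_max => /andP[N1j N2j].
by rewrite /interlace; case: ifP => _; [exact: qN|exact: pN].
Qed.

(** The alternation of [u] and [v] only has to be checked along two interlaced
    sequences, one on which [u] wins and one on which [v] wins. *)
Lemma alternate_interlaced (R : realType)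
    (mu1 mu2 : {measure set (measurableTypeR R) -> \bar R})
    (u v : R -> R) (beta : R) (p q : nat -> R) :
  measure_support mu1 beta ->
  ubound (measure_support mu1 `|` measure_support mu2) beta ->
  (forall k, p k < q k) -> (forall k, q k < p k.+1) ->
  p @ \oo --> beta -> q @ \oo --> beta ->
  (forall k, v (p k) < u (p k)) -> (forall k, u (q k) < v (q k)) ->
  alternate mu1 mu2 u v.
Proof.
move=> mub ubb pq qp pb qb up uq; exists beta; split => //; first by left.
(* The predecessor accounts for the indexing of the witness from 1. *)
exists (fun j => interlace p q j.-1); split.
- move=> [//|j] [|k] /=; first by rewrite ltn0.
  by rewrite ltnS; exact: interlace_lt.
- by rewrite -cvg_shiftS /=; exact: cvg_interlace.
- by move=> [//|k] _ /=; rewrite /interlace => /negbTE ->.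
- by move=> [//|k] _ /=; rewrite /interlace negbK => ->.
Qed.

Lemma ubound_measure_support (R : realType)
    (mu : {measure set (measurableTypeR R) -> \bar R}) (S : set R) (b : R) :
  carried_by mu S -> ubound S b -> ubound (measure_support mu) b.
Proof.
move=> [mS muS] Sb x mux; rewrite leNgt; apply/negP => bx.
have ob : open (`]b, +oo[%classic : set R) by exact: interval_open.
have := mux _ ob; rewrite /= in_itv/= andbT => /(_ bx); apply/negP.
rewrite -leNgt -muS.
apply: le_measure; rewrite ?inE//; first exact: measurableC.
by move=> y /=; rewrite in_itv/= andbT => by_ /Sb; rewrite leNgt by_.
Qed.

(** On [0, 1] all powers are bounded by the integrable constant 1. *)
Lemma tail_domain_unit_interval (R : realType)
    (mu : probability (measurableTypeR R) R) (S : set R) :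
  carried_by mu S -> S `<=` `[0, 1] -> tail_domain mu.
Proof.
move=> [mS muS] S01.
have mu01 : mu (~` `[0, 1]) = 0%E.
  apply/eqP; rewrite eq_le measure_ge0 andbT -muS.
  apply: le_measure; rewrite ?inE//; [exact: measurableC|exact: measurableC|].
  exact: subsetC.
split.
  split => //; apply/eqP; rewrite eq_le measure_ge0 andbT -mu01.
  apply: le_measure; rewrite ?inE//; [exact: measurableC|exact: measurableC|].
  by apply: subsetC => x /=; rewrite !in_itv/= => /andP[->].
move=> n.
have mX :
    measurable_fun [set: measurableTypeR R] (fun t => (t ^+ n)%:E : \bar R).
  by apply/measurable_EFinP; apply: measurable_funX.
apply/(negligible_integrable _ _ _ mu01) => //.
- exact: measurableC.
- exact: measurable_funTS.
rewrite setDE setCK.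
have -> : `[0, +oo[ `&` `[0, 1] = `[0, 1]%classic :> set R.
  apply/seteqP; split=> x /=; rewrite !in_itv/=; first by case.
  by move=> /andP[-> ->].
apply: (@le_integrable _ _ _ mu _ _ _ (cst 1%E)) => //.
- exact: measurable_funTS.
- move=> x /=; rewrite in_itv/= => /andP[x0 x1].
  by rewrite lee_fin normr1 ger0_norm ?exprn_ge0// exprn_ile1.
- by apply: finite_measure_integrable_cst.
Qed.

(** * Dyadic mixtures of measures *)

Section mixture.
Context d (T : measurableType d) (R : realType).
Local Open Scope ereal_scope.

Definition half_weight (k : nat) : {nonneg R} := ((1 / (2 ^ (k + 1))%:R)%:nng)%R.

Definition mixture (m : {measure set T -> \bar R}^nat) :
    {measure set T -> \bar R} :=
  mseries (fun k => mscale (half_weight k) (m k)) 0.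

Lemma mixtureE (m : {measure set T -> \bar R}^nat) A :
  mixture m A = \sum_(k <oo) (half_weight k)%:num%:E * m k A.
Proof. by []. Qed.

Lemma half_weight_gt0 k : (0 < (half_weight k)%:num)%R.
Proof. by rewrite divr_gt0// ltr0n expn_gt0. Qed.

Lemma mixture_term_ge0 (m : {measure set T -> \bar R}^nat) A k :
  0 <= (half_weight k)%:num%:E * m k A.
Proof. by rewrite mule_ge0// lee_fin ltW// half_weight_gt0. Qed.

Lemma sum_half_weight : \sum_(k <oo) (half_weight k)%:num%:E = 1 :> \bar R.
Proof.
apply/cvg_lim => //.
rewrite (_ : (fun n : nat => _) =
    EFin \o series (fun k => 1 / (2 ^ (k + 1))%:R : R)%R); last first.
  by apply/funext => n /=; rewrite sumEFin.
have := @cvg_geometric_series_half R 1 0.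
by rewrite expr0 divr1 => h; apply: cvg_EFin => //; exact: nearW.
Qed.

Lemma mixture_setT (m : {measure set T -> \bar R}^nat) :
  (forall k, m k setT = 1) -> mixture m setT = 1.
Proof.
move=> m1; rewrite mixtureE -[RHS]sum_half_weight.
by apply: eq_eseriesr => k _; rewrite m1 mule1.
Qed.

Lemma mixture0 (m : {measure set T -> \bar R}^nat) A :
  (forall k, m k A = 0) -> mixture m A = 0.
Proof. by move=> m0; rewrite mixtureE eseries0// => k _ _; rewrite m0 mule0. Qed.

Lemma mixture_gt0 (m : {measure set T -> \bar R}^nat) A k :
  0 < m k A -> 0 < mixture m A.
Proof.
move=> mk0; rewrite mixtureE (@nneseriesD1 _ _ k)//.
rewrite (@lt_le_trans _ _ ((half_weight k)%:num%:E * m k A))//.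
  by rewrite mule_gt0// lte_fin half_weight_gt0.
by rewrite leeDl// nneseries_ge0// => j _ _; exact: mixture_term_ge0.
Qed.

(** The components other than [k] have the same total in both mixtures; being
    finite, it cancels. This reduces every comparison of masses below to a
    single block of atoms. *)
Lemma mixture_lt (m1 m2 : {measure set T -> \bar R}^nat) A k :
  mixture m1 A < +oo -> (forall j, j != k -> m1 j A = m2 j A) ->
  m1 k A < m2 k A -> mixture m1 A < mixture m2 A.
Proof.
rewrite !mixtureE.
rewrite (@nneseriesD1 _ _ k)//.
rewrite [in X in _ -> _ -> _ < X](@nneseriesD1 _ _ k)//.
move=> fin m12 m12k.
have -> : \sum_(0 <= j <oo | true && (j != k)) (half_weight j)%:num%:E * m2 j A =
    \sum_(0 <= j <oo | true && (j != k)) (half_weight j)%:num%:E * m1 j A.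
  by apply: eq_eseriesr => j /= jk; rewrite m12.
have s0 : 0 <= \sum_(0 <= j <oo | true && (j != k))
    (half_weight j)%:num%:E * m1 j A.
  by apply: nneseries_ge0 => j _ _; exact: mixture_term_ge0.
rewrite lteD2rE; last first.
  rewrite ge0_fin_numE//; apply: le_lt_trans fin.
  by rewrite leeDr// mixture_term_ge0.
by rewrite lte_pmul2l// lte_fin half_weight_gt0.
Qed.

Lemma mixture_integral_le (m1 m2 : {measure set T -> \bar R}^nat) D
    (f : T -> \bar R) :
  measurable D -> measurable_fun D f -> (forall x, D x -> 0 <= f x) ->
  (forall k, \int[m1 k]_(x in D) f x <= \int[m2 k]_(x in D) f x) ->
  \int[mixture m1]_(x in D) f x <= \int[mixture m2]_(x in D) f x.
Proof.
move=> mD mf f0 m12; rewrite !ge0_integral_measure_series//.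
apply: lee_nneseries => k _; first by move=> _; exact: integral_ge0.
by rewrite !ge0_integral_mscale// lee_wpmul2l.
Qed.

End mixture.

Section probability_of_measure.
Context d (T : measurableType d) (R : realType).
Local Open Scope ereal_scope.
Variable mu : {measure set T -> \bar R}.

(** An alias of [mu] that remembers its total mass, on which the structure of
    probability measure can be declared. *)
Definition probability_fun & mu setT = 1 : set T -> \bar R := mu.

Hypothesis mu1 : mu setT = 1.

HB.instance Definition _ := Measure.on (probability_fun mu1).

HB.instance Definition _ :=
  Measure_isProbability.Build _ _ _ (probability_fun mu1) mu1.

Definition probability_of : probability T R := probability_fun mu1.

End probability_of_measure.

(** * Atoms and their mean-preserving spread *)

Lemma law_pmfE (R : realType) (mu : probability (measurableTypeR R) R) x :
  law_pmf mu x = fine (mu [set x]).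
Proof. by []. Qed.

Lemma law_cdfE (R : realType) (mu : probability (measurableTypeR R) R) x :
  law_cdf mu x = fine (mu `]-oo, x]%classic).
Proof. by []. Qed.

Lemma fine_probability_lt (R : realType)
    (mu nu : probability (measurableTypeR R) R) (A : set (measurableTypeR R)) :
  measurable A -> (mu A < nu A)%E -> fine (mu A) < fine (nu A).
Proof. by move=> mA munu; apply: fine_lt => //; exact: fin_num_measure. Qed.

Lemma probability_lty (R : realType) (mu : probability (measurableTypeR R) R)
    (A : set (measurableTypeR R)) :
  measurable A -> (mu A < +oo)%E.
Proof. by move=> mA; apply: le_lt_trans (probability_le1 mu mA) (ltry _). Qed.

(** Convexity of the n-th power, by induction on [n]: multiplying the bound for
    [n] by the convex combination leaves the error
    t (1 - t) (a - b) (a^n - b^n), which is nonnegative because the power is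
    nondecreasing. *)
Lemma convex_combination_expr (R : realFieldType) (t a b : R) (n : nat) :
  0 <= t <= 1 -> 0 <= a -> 0 <= b ->
  (t * a + (1 - t) * b) ^+ n <= t * a ^+ n + (1 - t) * b ^+ n.
Proof.
move=> /andP[t0 t1] a0 b0; elim: n => [|n IH]; first by rewrite !expr0; lra.
rewrite exprS.
apply: (@le_trans _ _ ((t * a + (1 - t) * b) * (t * a ^+ n + (1 - t) * b ^+ n))).
  by apply: ler_wpM2l => //; rewrite addr_ge0// mulr_ge0// subr_ge0.
rewrite -subr_ge0.
have -> : t * a ^+ n.+1 + (1 - t) * b ^+ n.+1 -
    (t * a + (1 - t) * b) * (t * a ^+ n + (1 - t) * b ^+ n) =
    t * (1 - t) * ((a - b) * (a ^+ n - b ^+ n)) by rewrite !exprS; ring.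
apply: mulr_ge0; first by rewrite mulr_ge0// subr_ge0.
have [ab|/ltW ba] := leP a b.
  by apply: mulr_le0; rewrite subr_le0// lerXn2r.
by apply: mulr_ge0; rewrite subr_ge0// lerXn2r.
Qed.

Section discrete.
Variable R : realType.

(** Block [k] lives at distance of order [gap k] from 1. The distances
    [gap k], [gap k / 2] and [gap k / 3] of its three points satisfy
    1/2 = 1/4 * 1 + 3/4 * 1/3, so the weights 1/4 and 3/4 put the barycentre of
    the outer points at the middle one; and [gap k / 3] exceeds the largest
    distance [gap k / 4] occurring in block [k.+1]. *)
Let gap (k : nat) : R := 4^-1 ^+ k.
Definition left_atom (k : nat) : R := 1 - gap k.
Definition mid_atom (k : nat) : R := 1 - gap k / 2.
Definition right_atom (k : nat) : R := 1 - gap k / 3.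

Let gap_gt0 k : 0 < gap k.
Proof. by rewrite exprn_gt0// invr_gt0. Qed.

Let gap_le1 k : gap k <= 1.
Proof. by rewrite exprn_ile1// ?invr_ge0// invf_le1// ler1n. Qed.

Let gapS k : gap k.+1 = gap k / 4.
Proof. by rewrite /gap exprSr. Qed.

Let cvg_gap (a : R) : 1 - gap k / a @[k --> \oo] --> (1 : R).
Proof.
rewrite -[X in _ --> X]subr0 -[X in _ - X](mul0r a^-1).
apply: cvgB; first exact: cvg_cst.
apply: cvgMl; apply: cvg_expr.
by rewrite ger0_norm ?invr_ge0// invf_lt1// ltr1n.
Qed.

Lemma cvg_left_atom : left_atom @ \oo --> (1 : R).
Proof. by have := @cvg_gap 1; under eq_fun do rewrite divr1. Qed.

Lemma cvg_mid_atom : mid_atom @ \oo --> (1 : R).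
Proof. exact: cvg_gap. Qed.

Lemma left_lt_mid k : left_atom k < mid_atom k.
Proof. by rewrite /left_atom /mid_atom; have := gap_gt0 k; lra. Qed.

Lemma mid_lt_right k : mid_atom k < right_atom k.
Proof. by rewrite /right_atom /mid_atom; have := gap_gt0 k; lra. Qed.

Lemma right_lt_left k : right_atom k < left_atom k.+1.
Proof. by rewrite /right_atom /left_atom gapS; have := gap_gt0 k; lra. Qed.

Lemma left_atom_le : {mono left_atom : i j / (i <= j)%N >-> i <= j}.
Proof.
apply: Order.NatMonotonyTheory.incnP => k.
exact: lt_trans (left_lt_mid _) (lt_trans (mid_lt_right _) (right_lt_left _)).
Qed.

Lemma right_lt_left_lt i j : (i < j)%N -> right_atom i < left_atom j.
Proof.
by move=> ij; apply: lt_le_trans (right_lt_left i) _; rewrite left_atom_le.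
Qed.

Lemma block_separated j k x : j != k -> left_atom k <= x <= right_atom k ->
  right_atom j < x \/ x < left_atom j.
Proof.
move=> jk /andP[lx xr]; move: jk; rewrite neq_ltn => /orP[jk|kj].
  by left; apply: lt_le_trans lx; exact: right_lt_left_lt.
by right; apply: le_lt_trans xr _; exact: right_lt_left_lt.
Qed.

Definition atoms : set R :=
  \bigcup_k [set left_atom k; mid_atom k; right_atom k].

Lemma atoms_ge0_lt1 x : atoms x -> 0 <= x < 1.
Proof.
move=> [k _]; rewrite /left_atom /mid_atom /right_atom /=.
by have := gap_gt0 k; have := gap_le1 k; move=> ? ? [[]|] ->; lra.
Qed.

Lemma countable_atoms : countable atoms.
Proof.
apply: bigcup_countable => // k _; apply: finite_set_countable.
by do ?[rewrite finite_setU; split].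
Qed.

Lemma card_atoms : (atoms #= [set: nat])%card.
Proof.
apply: eq_card_nat; first exact: countable_atoms.
apply/infiniteP/pcard_leP/injfunPex; exists left_atom.
  by move=> k _; exists k => //; left; left.
by move=> i j _ _; apply: (inc_inj left_atom_le).
Qed.

Lemma measurable_atoms : measurable (atoms : set (measurableTypeR R)).
Proof. exact: countable_measurable countable_atoms. Qed.

Definition mid_law (k : nat) : {measure set (measurableTypeR R) -> \bar R} :=
  @dirac _ (measurableTypeR R) (mid_atom k) R.

Definition spread_law (k : nat) : {measure set (measurableTypeR R) -> \bar R} :=
  measure_add (mscale (1 / 4)%:nng (@dirac _ (measurableTypeR R) (left_atom k) R))
              (mscale (3 / 4)%:nng (@dirac _ (measurableTypeR R) (right_atom k) R)).

Lemma mid_lawE k A : mid_law k A = (mid_atom k \in A)%:R%:E.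
Proof. by []. Qed.

Lemma spread_lawE k A : spread_law k A =
  (1 / 4 * (left_atom k \in A)%:R + 3 / 4 * (right_atom k \in A)%:R)%:E.
Proof.
by rewrite /spread_law -[LHS]/(measure_add _ _ A) measure_addE.
Qed.

Lemma mid_law_setT k : mid_law k setT = 1%E.
Proof. by rewrite mid_lawE in_setT. Qed.

Lemma spread_law_setT k : spread_law k setT = 1%E.
Proof. by rewrite spread_lawE !in_setT; congr EFin; rewrite /= !mulr1; lra. Qed.

Definition mid_mixture : probability (measurableTypeR R) R :=
  probability_of (mixture_setT mid_law_setT).

Definition spread_mixture : probability (measurableTypeR R) R :=
  probability_of (mixture_setT spread_law_setT).

Lemma carried_mid : carried_by mid_mixture atoms.
Proof.
split; first exact: measurable_atoms.
apply: (@mixture0 _ _ _ mid_law) => k; rewrite mid_lawE memNset//= => -[].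
by exists k => //; left; right.
Qed.

Lemma carried_spread : carried_by spread_mixture atoms.
Proof.
split; first exact: measurable_atoms.
apply: (@mixture0 _ _ _ spread_law) => k; rewrite spread_lawE !memNset/=.
- by rewrite !mulr0 addr0.
- by move=> []; exists k => //; right.
- by move=> []; exists k => //; left; left.
Qed.

Lemma mid_spread_integral_le k n :
  (\int[mid_law k]_(t in `[0%R, +oo[) (t ^+ n)%:E <=
   \int[spread_law k]_(t in `[0%R, +oo[) (t ^+ n)%:E)%E.
Proof.
have mX : measurable_fun (`[0, +oo[ : set (measurableTypeR R))
    (fun t => (t ^+ n)%:E).
  by apply/measurable_EFinP; apply: measurable_funTS; exact: measurable_funX.
have X0 (t : measurableTypeR R) : `[0, +oo[%classic t -> (0 <= (t ^+ n)%:E)%E.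
  by rewrite /= in_itv/= andbT => t0; rewrite lee_fin exprn_ge0.
rewrite ge0_integral_measure_add// !ge0_integral_mscale//.
have atom_ge0 (x : R) : atoms x -> (x \in (`[0, +oo[%classic : set R)).
  by move=> /atoms_ge0_lt1/andP[x0 _]; rewrite inE /= in_itv/= x0.
have lk : atoms (left_atom k) by exists k => //; left; left.
have mk : atoms (mid_atom k) by exists k => //; left; right.
have rk : atoms (right_atom k) by exists k => //; right.
rewrite !integral_dirac// !diracE !atom_ge0// !mul1e -!EFinM -EFinD lee_fin.
have -> : mid_atom k = 1 / 4 * left_atom k + 3 / 4 * right_atom k.
  by rewrite /mid_atom /left_atom /right_atom; field.
have /andP[l0 _] := atoms_ge0_lt1 lk; have /andP[r0 _] := atoms_ge0_lt1 rk.
have t01 : 0 <= (1 / 4 : R) <= 1 by lra.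
have := convex_combination_expr n t01 l0 r0.
by have -> : 1 - 1 / 4 = 3 / 4 :> R by field.
Qed.

Lemma tail_le_mid_spread : tail_le mid_mixture spread_mixture.
Proof.
have S01 : atoms `<=` `[0, 1].
  by move=> x /atoms_ge0_lt1/andP[x0 /ltW x1]; rewrite /= in_itv/= x0.
split; first exact: tail_domain_unit_interval carried_mid S01.
  exact: tail_domain_unit_interval carried_spread S01.
exists 0 => n _; apply: mixture_integral_le => //.
- by apply/measurable_EFinP; apply: measurable_funTS; exact: measurable_funX.
- by move=> t /=; rewrite in_itv/= andbT => t0; rewrite lee_fin exprn_ge0.
- by move=> k; exact: mid_spread_integral_le.
Qed.

Lemma ubound_support_discrete :
  ubound (measure_support mid_mixture `|` measure_support spread_mixture) 1.
Proof.
have S1 : ubound atoms 1 by move=> x /atoms_ge0_lt1/andP[_ /ltW].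
move=> x [].
  exact: ubound_measure_support carried_mid S1 x.
exact: ubound_measure_support carried_spread S1 x.
Qed.

Lemma support_mid1 : measure_support mid_mixture 1.
Proof.
move=> U oU U1.
have [N _ UN] := cvg_mid_atom (open_nbhs_nbhs (conj oU U1)).
apply: (@mixture_gt0 _ _ _ mid_law _ N); rewrite mid_lawE mem_set ?lte01//.
exact: (UN N (leqnn N)).
Qed.

(** Block [j] contributes the same mass to both laws on a set that does not
    separate its points. *)
Lemma mid_spread_eq (A : set R) j :
  (forall x, left_atom j <= x <= right_atom j -> A x) \/
  (forall x, left_atom j <= x <= right_atom j -> ~ A x) ->
  mid_law j A = spread_law j A.
Proof.
have lm := left_lt_mid j; have mr := mid_lt_right j.
rewrite mid_lawE spread_lawE => -[] jA.
- by rewrite !mem_set; [congr EFin; rewrite /= !mulr1; lra|apply: jA; lra..].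
- by rewrite !memNset; [congr EFin; rewrite /= !mulr0 addr0|apply: jA; lra..].
Qed.

Lemma mid_spread_set1 j k x : j != k -> left_atom k <= x <= right_atom k ->
  mid_law j [set x] = spread_law j [set x].
Proof.
move=> jk kx; apply: mid_spread_eq; right => y jy /= yx.
by case: (block_separated jk kx); lra.
Qed.

Lemma mid_spread_ray j k x : j != k -> left_atom k <= x <= right_atom k ->
  mid_law j `]-oo, x]%classic = spread_law j `]-oo, x]%classic.
Proof.
move=> jk kx; apply: mid_spread_eq.
case: (block_separated jk kx) => h; [left|right] => y jy /=;
  by rewrite in_itv/=; lra.
Qed.

(** The middle atom of a block comes before the left atom of the next one, so
    it is enough to compare the two laws at middle and at left atoms. *)
Lemma alternate_discrete (u v : R -> R) :
  (forall k, v (mid_atom k) < u (mid_atom k)) ->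
  (forall k, u (left_atom k) < v (left_atom k)) ->
  alternate mid_mixture spread_mixture u v.
Proof.
move=> um ul; apply: (@alternate_interlaced _ _ _ _ _ 1 mid_atom
    (fun k => left_atom k.+1)) => //.
- exact: support_mid1.
- exact: ubound_support_discrete.
- by move=> k; apply: lt_trans (mid_lt_right k) (right_lt_left k).
- by move=> k; exact: left_lt_mid.
- exact: cvg_mid_atom.
- by rewrite cvg_shiftS; exact: cvg_left_atom.
Qed.

Lemma alternate_pmf_discrete : alternate mid_mixture spread_mixture
  (law_pmf mid_mixture) (law_pmf spread_mixture).
Proof.
apply: alternate_discrete => k; have lm := left_lt_mid k;
  have mr := mid_lt_right k; rewrite !law_pmfE;
  apply: fine_probability_lt => //; apply: (@mixture_lt _ _ _ _ _ _ k).
- exact: (@probability_lty _ spread_mixture).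
- by move=> j jk; rewrite (mid_spread_set1 jk)//; lra.
- rewrite mid_lawE spread_lawE (@mem_set _ _ (mid_atom k))// !memNset/=.
  + by rewrite lte_fin; lra.
  + by move=> ?; lra.
  + by move=> ?; lra.
- exact: (@probability_lty _ mid_mixture).
- by move=> j jk; rewrite (mid_spread_set1 jk)//; lra.
- rewrite mid_lawE spread_lawE (@mem_set _ _ (left_atom k))// !memNset/=.
  + by rewrite lte_fin; lra.
  + by move=> ?; lra.
  + by move=> ?; lra.
Qed.

Lemma alternate_cdf_discrete : alternate mid_mixture spread_mixture
  (law_cdf mid_mixture) (law_cdf spread_mixture).
Proof.
apply: alternate_discrete => k; have lm := left_lt_mid k;
  have mr := mid_lt_right k; rewrite !law_cdfE;
  apply: fine_probability_lt => //; apply: (@mixture_lt _ _ _ _ _ _ k).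
- exact: (@probability_lty _ spread_mixture).
- by move=> j jk; rewrite (mid_spread_ray jk)//; lra.
- rewrite mid_lawE spread_lawE (@mem_set _ _ (mid_atom k)); last first.
    by rewrite /= in_itv/=.
  rewrite mem_set/= ?in_itv/=; last lra.
  rewrite memNset/= ?in_itv/=; last lra.
  by rewrite lte_fin; lra.
- exact: (@probability_lty _ mid_mixture).
- by move=> j jk; rewrite (mid_spread_ray jk)//; lra.
- rewrite mid_lawE spread_lawE (@mem_set _ _ (left_atom k)); last first.
    by rewrite /= in_itv/=.
  rewrite !memNset/= ?in_itv/=; [|lra|lra].
  by rewrite lte_fin; lra.
Qed.

End discrete.

(** * Laws with a density *)

Section density.
Context (R : realType) (f : R -> R).
Local Notation leb := (@lebesgue_measure R).

Definition density_measure & measurable_fun [set: measurableTypeR R] f &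
    (forall x, 0 <= f x) : set (measurableTypeR R) -> \bar R :=
  fun A => (\int[leb]_(x in A) (f x)%:E)%E.

Hypothesis mf : measurable_fun [set: measurableTypeR R] f.
Hypothesis f0 : forall x, 0 <= f x.

Let density_measure0 : density_measure mf f0 set0 = 0%E.
Proof. exact: integral_set0. Qed.

Let density_measure_ge0 A : (0 <= density_measure mf f0 A)%E.
Proof. by apply: integral_ge0 => x _; rewrite lee_fin. Qed.

Let density_measure_sigma_additive : semi_sigma_additive (density_measure mf f0).
Proof.
move=> F mF tF mUF; rewrite /density_measure; apply: cvg_toP.
  apply: ereal_nondecreasing_is_cvgn => m n mn.
  apply: lee_sum_nneg_natr => // k _ _.
  by apply: integral_ge0 => x _; rewrite lee_fin.
rewrite ge0_integral_bigcup//.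
- by apply/measurable_EFinP; exact: measurable_funTS.
- by move=> x _; rewrite lee_fin.
Qed.

HB.instance Definition _ := isMeasure.Build _ _ _ (density_measure mf f0)
  density_measure0 density_measure_ge0 density_measure_sigma_additive.

Lemma is_density_exists : (\int[leb]_x (f x)%:E = 1)%E ->
  exists mu : probability (measurableTypeR R) R, is_density mu f.
Proof.
move=> f1; have mu1 : density_measure mf f0 setT = 1%E by [].
by exists (probability_of mu1); split.
Qed.

End density.

(** By continuity [f] stays above [f x / 2] on a ball inside [U]. *)
Lemma continuous_integral_gt0 (R : realType) (f : R -> R) (U : set R) (x : R) :
  continuous f -> (forall y, 0 <= f y) -> open U -> U x -> 0 < f x ->
  (0 < \int[lebesgue_measure]_(y in U) (f y)%:E)%E.
Proof.
move=> cf f0 oU Ux fx0.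
have mf : measurable_fun [set: measurableTypeR R] f.
  exact: continuous_measurable_fun.
have : nbhs x (U `&` [set y | f x / 2 < f y]).
  apply: filterI; first exact: open_nbhs_nbhs.
  by apply: (cf x (fun y => f x / 2 < y)); apply: lt_nbhsr; lra.
move=> /nbhs_ballP[e /= e0 eU].
have mb : measurable (ball x e : set (measurableTypeR R)).
  exact: measurable_ball.
apply: (@lt_le_trans _ _
    (\int[lebesgue_measure]_(y in ball x e) (cst (f x / 2)%:E y))%E).
  rewrite integral_cst// [X in (_ * X)%E](lebesgue_measure_ball x (ltW e0)).
  by rewrite -EFinM lte_fin mulr_gt0 ?divr_gt0// mulrn_wgt0.
apply: (@le_trans _ _ (\int[lebesgue_measure]_(y in ball x e) (f y)%:E)%E).
  apply: ge0_le_integral => //.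
  - by move=> y _; rewrite lee_fin; lra.
  - by apply/measurable_EFinP; exact: measurable_funTS.
  - by move=> y /eU[_ /= /ltW].
apply: ge0_subset_integral => //.
- exact: open_measurable.
- by apply/measurable_EFinP; exact: measurable_funTS.
- by move=> y _; rewrite lee_fin.
- by move=> y /eU[].
Qed.

Section is_density.
Context (R : realType) (mu : probability (measurableTypeR R) R) (f : R -> R).
Hypothesis muf : is_density mu f.
Local Notation leb := (@lebesgue_measure R).

Lemma is_density_dominates : mu `<< leb.
Proof.
have [mf f0 muE] := muf; apply/null_content_dominatesP => A mA A0.
rewrite muE// null_set_integral//.
by apply/measurable_EFinP; exact: measurable_funTS.
Qed.

(** A density agrees almost everywhere with the Radon-Nikodym derivative, for
    which the change of variables is known. *)
Lemma is_density_integral (D : set (measurableTypeR R)) (phi : R -> \bar R) :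
  measurable D -> mu.-integrable D phi ->
  (\int[mu]_(x in D) phi x = \int[leb]_(x in D) (phi x * (f x)%:E))%E.
Proof.
move=> mD iphi; have [mf f0 muE] := muf.
have mphi := measurable_int _ iphi.
have dom := is_density_dominates.
rewrite -(Radon_Nikodym_change_of_variables dom)//.
apply: ae_eq_integral => //.
- apply: emeasurable_funM => //; apply: (measurable_int leb).
  apply: (integrableS _ _ (@subsetT _ _)) => //=.
  exact: Radon_Nikodym_integrable.
- apply: emeasurable_funM => //.
  by apply/measurable_EFinP; exact: measurable_funTS.
- apply: ae_eqe_mul2l => /=.
  rewrite Radon_NikodymE//=.
  case: cid => /= h [h1 h2 h3].
  apply: integral_ae_eq => //=.
  + exact: integrableS h2.
  + by apply/measurable_EFinP; exact: measurable_funTS.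
  + by move=> E E01 mE; rewrite -h3//= -muE.
Qed.

End is_density.

(** * Densities vanishing outside the unit interval *)

Lemma integral_support01 (R : realType) (f : R -> R)
    (D : set (measurableTypeR R)) :
  measurable D -> (forall x, ~~ (0 <= x <= 1) -> f x = 0) ->
  (\int[lebesgue_measure]_(x in D) (f x)%:E =
   \int[lebesgue_measure]_(x in D `&` `[0%R, 1%R]) (f x)%:E)%E.
Proof.
move=> mD f_out; rewrite [RHS]integral_mkcondr; apply: eq_integral => x _.
rewrite patchE; case: ifPn => //.
by rewrite notin_setE /= in_itv/= => /negP /f_out ->.
Qed.

Lemma is_density_carried01 (R : realType)
    (mu : probability (measurableTypeR R) R) (f : R -> R) :
  is_density mu f -> (forall x, ~~ (0 <= x <= 1) -> f x = 0) ->
  carried_by mu `[0, 1].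
Proof.
move=> [mf f0 muE] f_out; split => //.
have m01 : measurable (~` `[0, 1] : set (measurableTypeR R)).
  exact: measurableC.
apply: (etrans (muE _ m01)).
by rewrite integral_support01// setICl integral_set0.
Qed.

Lemma density_moment (R : realType)
    (mu : probability (measurableTypeR R) R) (f : R -> R) (n : nat) :
  is_density mu f -> (forall x, ~~ (0 <= x <= 1) -> f x = 0) ->
  moment mu n =
  (\int[lebesgue_measure]_(x in `[0%R, 1%R]) (x ^+ n * f x)%:E)%E.
Proof.
move=> muf f_out; have mu01 := is_density_carried01 muf f_out.
have [_ /(_ n) imu] := tail_domain_unit_interval mu01 (@subset_refl _ _).
rewrite /moment (is_density_integral muf)//.
under eq_integral do rewrite -EFinM.
rewrite (@integral_support01 _ (fun x => x ^+ n * f x))//; last first.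
  by move=> x /f_out ->; rewrite mulr0.
congr integral; apply/seteqP; split => x /=; rewrite !in_itv/=; first by case.
by move=> /andP[-> ->].
Qed.

Lemma density_cdf (R : realType)
    (mu : probability (measurableTypeR R) R) (f : R -> R) (b : R) :
  is_density mu f -> (forall x, ~~ (0 <= x <= 1) -> f x = 0) -> b <= 1 ->
  law_cdf mu b = fine (\int[lebesgue_measure]_(x in `[0%R, b]) (f x)%:E)%E.
Proof.
move=> [mf f0 muE] f_out b1; rewrite law_cdfE muE// integral_support01//.
congr (fine (integral _ _ _)); apply/seteqP; split => x /=; rewrite !in_itv/=.
  by move=> [-> /andP[->]].
by move=> /andP[-> xb]; rewrite xb (le_trans xb).
Qed.

(** * Perturbing by a second derivative *)

Section second_derivative.
Context (R : realType).
Local Notation leb := (@lebesgue_measure R).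

Lemma continuous_integrable01 (f : R -> R) (D : set (measurableTypeR R)) :
  continuous f -> measurable D -> D `<=` `[0, 1] ->
  leb.-integrable D (EFin \o f).
Proof.
move=> cf mD D01.
have : leb.-integrable `[0, 1] (EFin \o f).
  apply: continuous_compact_integrable; first exact: segment_compact.
  exact: continuous_subspaceT.
by apply: integrableS D01.
Qed.

Lemma continuous_FTC01 (F f : R -> R) (b : R) : continuous F -> continuous f ->
  (forall x : R, 0 < x < 1 -> is_derive x 1 F (f x)) -> 0 < b <= 1 ->
  (\int[leb]_(x in `[0%R, b]) (f x)%:E = (F b - F 0)%:E)%E.
Proof.
move=> cF cf dF /andP[b0 b1]; rewrite (@continuous_FTC2 _ f F 0 b)//.
- exact: continuous_subspaceT.
- split.
  + move=> x; rewrite in_itv/= => /andP[x0 xb].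
    by have [] : is_derive x 1 F (f x) by apply: dF; rewrite x0 (lt_le_trans xb).
  + by apply: cvg_at_right_filter; exact: cF.
  + by apply: cvg_at_left_filter; exact: cF.
- move=> x; rewrite in_itv/= => /andP[x0 xb].
  have [_ <-] : is_derive x 1 F (f x) by apply: dF; rewrite x0 (lt_le_trans xb).
  by rewrite derive1E.
Qed.

(** [k1] and [k2] are the first two derivatives of [k0] inside ]0, 1[; the
    boundary values remove all boundary terms from the integrations by
    parts. *)
Variables (k0 k1 k2 : R -> R).
Hypothesis ck0 : continuous k0.
Hypothesis ck1 : continuous k1.
Hypothesis ck2 : continuous k2.
Hypothesis dk0 : forall x : R, 0 < x < 1 -> is_derive x 1 k0 (k1 x).
Hypothesis dk1 : forall x : R, 0 < x < 1 -> is_derive x 1 k1 (k2 x).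
Hypothesis k0_ge0 : forall x, 0 <= x <= 1 -> 0 <= k0 x.
Hypothesis k00 : k0 0 = 0.
Hypothesis k01 : k0 1 = 0.
Hypothesis k10 : k1 0 = 0.
Hypothesis k11 : k1 1 = 0.
Hypothesis k20 : k2 0 = 0.
Hypothesis k21 : k2 1 = 0.

(** Both integrations by parts are done at once: x^n k2 - n (n-1) x^(n-2) k0 is
    the derivative of x^n k1 - n x^(n-1) k0, which vanishes at 0 and 1, so the
    moment of [k2] equals the integral of n (n-1) x^(n-2) k0. The truncated
    predecessors are harmless, since the factor n or n - 1 vanishes whenever
    one of them is off. *)
Lemma moment_second_derivative_ge0 (n : nat) :
  (0 <= \int[leb]_(x in `[0%R, 1%R]) (x ^+ n * k2 x)%:E)%E.
Proof.
pose e (x : R) : R := n%:R * n.-1%:R * x ^+ n.-2 * k0 x.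
pose Phi (x : R) : R := x ^+ n * k1 x - n%:R * x ^+ n.-1 * k0 x.
pose phi (x : R) : R := x ^+ n * k2 x - e x.
have cX m : continuous (fun x : R => x ^+ m) by exact: exprn_continuous.
have ce : continuous e.
  by move=> x; apply: (cvgM _ (@ck0 x)); apply: (cvgM _ (cX _ x)); exact: cvg_cst.
have cphi : continuous phi.
  by move=> x; apply: (cvgB _ (ce x)); exact: (cvgM (cX _ x) (@ck2 x)).
have cPhi : continuous Phi.
  move=> x; apply: cvgB; first exact: (cvgM (cX _ x) (@ck1 x)).
  by apply: (cvgM _ (@ck0 x)); apply: (cvgM _ (cX _ x)); exact: cvg_cst.
have dPhi (x : R) : 0 < x < 1 -> is_derive x 1 Phi (phi x).
  move=> x01; have := dk0 x01; have := dk1 x01 => d1 d0.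
  rewrite (_ : Phi = (id ^+ n * k1 - n%:R *: (id ^+ n.-1 * k0))%R); last first.
    apply/funext => y.
    by rewrite /Phi !fctE /GRing.scale/= mulrA.
  apply: is_derive_eq.
  rewrite /phi /e !fctE /GRing.scale/= !mulr1.
  by move: (x ^+ n) (x ^+ n.-1) (x ^+ n.-2) => *; ring.
have -> : (\int[leb]_(x in `[0%R, 1%R]) (x ^+ n * k2 x)%:E =
    \int[leb]_(x in `[0%R, 1%R]) ((phi x)%:E + (e x)%:E))%E.
  by apply: eq_integral => x _; rewrite -EFinD subrK.
rewrite integralD_EFin//; [|exact: continuous_integrable01..].
rewrite (@continuous_FTC01 Phi)//; last by rewrite ltr01 lexx.
rewrite /Phi k00 k01 k10 k11 !mulr0 !subr0 add0e.
apply: integral_ge0 => x; rewrite /= in_itv/= => x01.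
rewrite lee_fin /e mulr_ge0 ?k0_ge0// mulr_ge0// exprn_ge0//.
by case/andP : x01.
Qed.

(** Precomposing [k2] with the projection onto [0, 1] cuts it off outside
    [0, 1] while keeping it continuous, because [k2] vanishes at 0 and 1. *)
Let clamp (x : R) : R := Num.max 0 (Num.min x 1).

Let h (x : R) : R := k2 (clamp x).

Let h01 x : 0 <= x <= 1 -> h x = k2 x.
Proof. by move=> /andP[x0 x1]; rewrite /h /clamp min_l// max_r. Qed.

Let h_out x : ~~ (0 <= x <= 1) -> h x = 0.
Proof.
rewrite negb_and -!ltNge /h /clamp => /orP[x0|x1].
  by rewrite min_l ?max_l ?(ltW x0)// (le_trans (ltW x0)).
by rewrite min_r ?max_r ?(ltW x1).
Qed.

Let ch : continuous h.
Proof.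
move=> x; apply: continuous_comp; last exact: ck2.
apply: (@continuous_max R R (cst 0) (fun y => Num.min y 1)).
  exact: cvg_cst.
by apply: (@continuous_min R R id (cst 1)); [exact: cvg_id|exact: cvg_cst].
Qed.

Let neg (x : R) : R := Num.max 0 (- h x).
Let pos (x : R) : R := Num.max 0 (h x).

Let posE x : pos x = neg x + h x.
Proof. by rewrite /pos /neg; case: (leP 0 (h x)); case: (leP 0 (- h x)); lra. Qed.

Let neg_ge0 x : 0 <= neg x.
Proof. by rewrite /neg le_max lexx. Qed.

Let pos_ge0 x : 0 <= pos x.
Proof. by rewrite /pos le_max lexx. Qed.

Let cneg : continuous neg.
Proof.
move=> x; apply: (@continuous_max R R (cst 0) (fun y => - h y)).
  exact: cvg_cst.
by apply: cvgN; exact: ch.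
Qed.

Let cpos : continuous pos.
Proof.
move=> x; apply: (@continuous_max R R (cst 0) h); last exact: ch.
exact: cvg_cst.
Qed.

Let integral_h b : 0 < b <= 1 ->
  (\int[leb]_(x in `[0%R, b]) (h x)%:E = (k1 b)%:E)%E.
Proof.
move=> /andP[b0 b1]; have -> : k1 b = k1 b - k1 0 by rewrite k10 subr0.
rewrite -(@continuous_FTC01 k1 k2)//; last by rewrite b0.
apply: eq_integral => x; rewrite inE/= in_itv/= => /andP[x0 xb].
by rewrite h01// x0 (le_trans xb).
Qed.

(** The common mass of the two parts of [h]; it normalises both of them. *)
Let m : R := fine (\int[leb]_(x in `[0%R, 1%R]) (neg x)%:E)%E.

Let integral_neg : (\int[leb]_(x in `[0%R, 1%R]) (neg x)%:E = m%:E)%E.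
Proof.
rewrite /m fineK//; apply: integrable_fin_num => //.
exact: continuous_integrable01.
Qed.

Let integral_pos : (\int[leb]_(x in `[0%R, 1%R]) (pos x)%:E = m%:E)%E.
Proof.
under eq_integral do rewrite posE EFinD.
rewrite integralD_EFin//; [|exact: continuous_integrable01..].
by rewrite integral_neg integral_h ?k11 ?adde0// ltr01 lexx.
Qed.

Let density_of (f : R -> R) : continuous f -> (forall x, 0 <= f x) ->
  (forall x, ~~ (0 <= x <= 1) -> f x = 0) ->
  (\int[leb]_(x in `[0%R, 1%R]) (f x)%:E = m%:E)%E -> 0 < m ->
  exists mu : probability (measurableTypeR R) R,
    is_density mu (fun x => f x / m).
Proof.
move=> cf f0 f_out fm m0; apply: is_density_exists.
- apply: continuous_measurable_fun => x.
  by apply: (cvgM (cf x)); exact: cvg_cst.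
- by move=> x; rewrite divr_ge0// ltW.
- rewrite (@integral_support01 _ (fun x => f x / m))//; last first.
    by move=> x /f_out ->; rewrite mul0r.
  rewrite setTI; under eq_integral do rewrite /= EFinM.
  rewrite ge0_integralZr//.
  + by rewrite fm -EFinM divff// gt_eqF.
  + apply/measurable_EFinP; apply: measurable_funTS.
    exact: continuous_measurable_fun.
  + by move=> x _; rewrite lee_fin.
  + by rewrite lee_fin invr_ge0 ltW.
Qed.

(** The densities are the two parts of [k2] divided by their common mass [m],
    and [c] is the inverse of [m]. The point [p] only serves to make [m]
    positive. *)
Lemma second_derivative_density_pair (p : R) : 0 < p < 1 -> k2 p < 0 ->
  exists (mu_f mu_g : probability (measurableTypeR R) R) (f g : R -> R) (c : R),
  [/\ is_density mu_f f, is_density mu_g g, continuous f & continuous g] /\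
  [/\ carried_by mu_f `[0, 1], carried_by mu_g `[0, 1] & tail_le mu_f mu_g] /\
  [/\ 0 < c, forall x, 0 < x < 1 -> g x - f x = c * k2 x &
      forall x, 0 < x < 1 -> law_cdf mu_g x - law_cdf mu_f x = c * k1 x].
Proof.
move=> p01 k2p.
have neg_out x : ~~ (0 <= x <= 1) -> neg x = 0.
  by move=> /h_out hx; rewrite /neg hx oppr0 maxxx.
have pos_out x : ~~ (0 <= x <= 1) -> pos x = 0.
  by move=> /h_out hx; rewrite /pos hx maxxx.
have m_gt0 : 0 < m.
  rewrite -lte_fin -integral_neg.
  apply: (@lt_le_trans _ _ (\int[leb]_(x in `]0%R, 1%R[) (neg x)%:E)%E).
    apply: (@continuous_integral_gt0 _ neg `]0, 1[ p) => //=.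
      by rewrite /neg h01 ?lt_max; lra.
  apply: ge0_subset_integral => //.
  - apply/measurable_EFinP; apply: measurable_funTS.
    exact: continuous_measurable_fun.
  - by move=> x _; rewrite lee_fin.
  - exact: subset_itv_oo_cc.
have [mu_f df] := density_of cneg neg_ge0 neg_out integral_neg m_gt0.
have [mu_g dg] := density_of cpos pos_ge0 pos_out integral_pos m_gt0.
have f_out x : ~~ (0 <= x <= 1) -> neg x / m = 0.
  by move=> /neg_out ->; rewrite mul0r.
have g_out x : ~~ (0 <= x <= 1) -> pos x / m = 0.
  by move=> /pos_out ->; rewrite mul0r.
have cf : continuous (fun x => neg x / m).
  by move=> x; apply: (cvgM (@cneg x)); exact: cvg_cst.
have cg : continuous (fun x => pos x / m).
  by move=> x; apply: (cvgM (@cpos x)); exact: cvg_cst.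
have f01 := is_density_carried01 df f_out.
have g01 := is_density_carried01 dg g_out.
exists mu_f, mu_g, (fun x => neg x / m), (fun x => pos x / m), m^-1.
split; first by [].
split.
  split => //; split; first exact: tail_domain_unit_interval f01 _.
    exact: tail_domain_unit_interval g01 _.
  exists 0 => n _; rewrite (density_moment _ df)// (density_moment _ dg)//.
  have cX : continuous (fun x : R => x ^+ n) by exact: exprn_continuous.
  have cXf : continuous (fun x : R => x ^+ n * (neg x / m)).
    by move=> x; exact: cvgM (cX x) (cf x).
  have cXk : continuous (fun x : R => x ^+ n * k2 x).
    by move=> x; exact: cvgM (cX x) (@ck2 x).
  have -> : (\int[leb]_(x in `[0%R, 1%R]) (x ^+ n * (pos x / m))%:E =
      \int[leb]_(x in `[0%R, 1%R])
        ((x ^+ n * (neg x / m))%:E + (m^-1 * (x ^+ n * k2 x))%:E))%E.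
    apply: eq_integral => x; rewrite inE/= in_itv/= => x01.
    by rewrite -EFinD posE h01//; congr EFin; ring.
  rewrite integralD_EFin//; first last.
  - apply: (@continuous_integrable01 (fun x => m^-1 * (x ^+ n * k2 x))) => //.
    by move=> x; apply: cvgM (cXk x); exact: cvg_cst.
  - exact: (@continuous_integrable01 (fun x => x ^+ n * (neg x / m))).
  rewrite leeDl//; under eq_integral do rewrite /= EFinM.
  rewrite integralZl//; last first.
    exact: (@continuous_integrable01 (fun x => x ^+ n * k2 x)).
  by rewrite mule_ge0 ?moment_second_derivative_ge0// lee_fin invr_ge0 ltW.
split; first by rewrite invr_gt0.
- by move=> x x01; rewrite posE h01; [ring|lra].
- move=> b b01; rewrite (density_cdf df)//; last lra.
  rewrite (density_cdf dg)//; last lra.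
  have b01' : `[0, b] `<=` (`[0, 1]%classic : set R).
    by apply: subset_itvl; rewrite bnd_simp; lra.
  have if_ := continuous_integrable01 cf (measurable_itv `[0, b]) b01'.
  have -> : (\int[leb]_(x in `[0%R, b]) (pos x / m)%:E =
      \int[leb]_(x in `[0%R, b]) ((neg x / m)%:E + (m^-1 * h x)%:E))%E.
    by apply: eq_integral => x _; rewrite -EFinD posE; congr EFin; ring.
  rewrite integralD_EFin//; last first.
    apply: (@continuous_integrable01 (fun x => m^-1 * h x)) => //.
    by move=> x; apply: cvgM (@ch x); exact: cvg_cst.
  under [X in (_ + X)%E]eq_integral do rewrite /= EFinM.
  rewrite integralZl//; last exact: continuous_integrable01.
  rewrite integral_h; last lra.
  rewrite fineD//; last exact: integrable_fin_num.
  by rewrite addrC addKr.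
Qed.

End second_derivative.

(** * A nonnegative function oscillating at one *)

Section oscillation.
Variable R : realType.
Implicit Types x : R.

Let S x : R := sin (pi / (1 - x)).
Let C x : R := cos (pi / (1 - x)).

(** The sine and cosine have no limit at 1, but a single factor 1 - x makes
    any monomial in them continuous there. All functions below are built from
    these blocks. *)
Let osc (i j : nat) x : R := (1 - x) * (S x ^+ i * C x ^+ j).

Let continuous_osc i j : continuous (osc i j).
Proof.
move=> x; have [->|x1] := eqVneq x 1.
  apply/cvgrPdist_le => e e0.
  rewrite /osc subrr mul0r; near=> y.
  rewrite sub0r normrN !normrM.
  apply: (@le_trans _ _ `|1 - y|).
    by rewrite ler_piMr// mulr_ile1// normrX exprn_ile1// ?sin_max// cos_max.
  by near: y; apply/nbhs_ballP; exists e => // z; rewrite /ball/= => /ltW.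
have ca : {for x, continuous (fun y : R => pi / (1 - y))}.
  apply: cvgM; first exact: cvg_cst.
  apply: cvgV; first by rewrite subr_eq0 eq_sym.
  by apply: cvgB; [exact: cvg_cst|exact: cvg_id].
have cS : {for x, continuous S}.
  by apply: (@continuous_comp _ _ _ _ sin _ ca); exact: continuous_sin.
have cC : {for x, continuous C}.
  by apply: (@continuous_comp _ _ _ _ cos _ ca); exact: continuous_cos.
apply: cvgM; first by apply: cvgB; [exact: cvg_cst|exact: cvg_id].
apply: cvgM.
  apply: (@continuous_comp _ _ _ S (fun z => z ^+ i) _ cS).
  exact: exprn_continuous.
apply: (@continuous_comp _ _ _ C (fun z => z ^+ j) _ cC).
exact: exprn_continuous.
Unshelve. all: by end_near. Qed.

(** The fourth power of the sine makes [k0], [k1] and [k2] vanish at 0, where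
    the phase is pi; the fifth power of 1 - x leaves one factor 1 - x in [k2],
    which makes them vanish at 1. *)
Let k0 x : R := (1 - x) ^+ 5 * S x ^+ 4.

Let k1 x : R :=
  4 * pi * ((1 - x) ^+ 3 * S x ^+ 3 * C x) - 5 * ((1 - x) ^+ 4 * S x ^+ 4).

Let k2 x : R :=
  20 * (1 - x) ^+ 3 * S x ^+ 4 - 32 * pi * (1 - x) ^+ 2 * S x ^+ 3 * C x +
  4 * pi ^+ 2 * (1 - x) * (3 * S x ^+ 2 * C x ^+ 2 - S x ^+ 4).

Let cX (c : R) n : continuous (fun x => c * (1 - x) ^+ n).
Proof.
move=> x; apply: cvgM; first exact: cvg_cst.
apply: (@continuous_comp _ _ _ (fun y : R => 1 - y) (fun z : R => z ^+ n)).
  by apply: cvgB; [exact: cvg_cst|exact: cvg_id].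
exact: exprn_continuous.
Qed.

Let continuous_k0 : continuous k0.
Proof.
rewrite (_ : k0 = fun x => 1 * (1 - x) ^+ 4 * osc 4 0 x); last first.
  by apply/funext => x; rewrite /k0 /osc; ring.
by move=> x; exact: (cvgM (@cX _ _ x) (@continuous_osc _ _ x)).
Qed.

Let continuous_k1 : continuous k1.
Proof.
rewrite (_ : k1 = fun x => 4 * pi * (1 - x) ^+ 2 * osc 3 1 x -
    5 * (1 - x) ^+ 3 * osc 4 0 x); last first.
  by apply/funext => x; rewrite /k1 /osc; ring.
move=> x; apply: cvgB.
  exact: (cvgM (@cX _ _ x) (@continuous_osc _ _ x)).
exact: (cvgM (@cX _ _ x) (@continuous_osc _ _ x)).
Qed.

Let continuous_k2 : continuous k2.
Proof.
rewrite (_ : k2 = fun x => 20 * (1 - x) ^+ 2 * osc 4 0 x -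
    32 * pi * (1 - x) ^+ 1 * osc 3 1 x +
    (12 * pi ^+ 2 * (1 - x) ^+ 0 * osc 2 2 x -
     4 * pi ^+ 2 * (1 - x) ^+ 0 * osc 4 0 x)); last first.
  by apply/funext => x; rewrite /k2 /osc; ring.
move=> x; apply: cvgD; apply: cvgB;
  exact: (cvgM (@cX _ _ x) (@continuous_osc _ _ x)).
Qed.

Let is_derive_phase x : x < 1 ->
  is_derive x 1 (fun y => pi / (1 - y)) (pi / (1 - x) ^+ 2).
Proof.
move=> x1; have s0 : (cst 1 - id) x != 0 :> R by rewrite gt_eqF// subr_gt0.
have d := is_deriveV s0
  (is_deriveB (is_derive_cst (1 : R^o) x 1) (is_derive_id x (1 : R^o))).
have d' : is_derive x 1 (fun y : R => pi / (1 - y)) _ := is_deriveZ pi d.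
apply: is_derive_eq.
by rewrite !fctE /GRing.scale/=; ring.
Qed.

Let is_derive_S x : x < 1 -> is_derive x 1 S (C x * (pi / (1 - x) ^+ 2)).
Proof.
by move=> x1; exact: is_derive1_comp (is_derive_sin _) (is_derive_phase x1).
Qed.

Let is_derive_C x : x < 1 -> is_derive x 1 C (- S x * (pi / (1 - x) ^+ 2)).
Proof.
by move=> x1; exact: is_derive1_comp (is_derive_cos _) (is_derive_phase x1).
Qed.

Let is_derive_k0 x : x < 1 -> is_derive x 1 k0 (k1 x).
Proof.
move=> x1; have dS := is_derive_S x1.
rewrite (_ : k0 = ((cst 1 - id) ^+ 5 * S ^+ 4)%R); last first.
  by apply/funext => y; rewrite !fctE.
apply: is_derive_eq; rewrite !fctE /GRing.scale/= /k1.
have s0 : 1 - x != 0 by rewrite gt_eqF// subr_gt0.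
by field.
Qed.

Let is_derive_k1 x : x < 1 -> is_derive x 1 k1 (k2 x).
Proof.
move=> x1; have dS := is_derive_S x1; have dC := is_derive_C x1.
rewrite (_ : k1 = ((4 * pi) *: ((cst 1 - id) ^+ 3 * S ^+ 3 * C) -
    5 *: ((cst 1 - id) ^+ 4 * S ^+ 4))%R); last first.
  by apply/funext => y; rewrite !fctE.
apply: is_derive_eq; rewrite !fctE /GRing.scale/= /k2.
have s0 : 1 - x != 0 by rewrite gt_eqF// subr_gt0.
by field.
Qed.


(** The point where the phase pi / (1 - x) equals a pi modulo pi, in its n-th
    occurrence. The offset 2 keeps these points in [1/2, 1[, where the leading
    trigonometric terms of [k1] and [k2] dominate. *)
Let pt (a : R) (n : nat) : R := 1 - (n.+2%:R + a)^-1.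

Let pt_gap (a : R) n : 0 < a < 1 -> 0 < 1 - pt a n <= 1 / 2.
Proof.
move=> /andP[a0 a1]; rewrite /pt opprB addrC subrK.
have n2 : 2 <= n.+2%:R + a.
  by apply: ler_wpDr; [exact: ltW|rewrite (ler_nat _ 2)].
by rewrite invr_gt0 div1r lef_pV2 ?posrE//; lra.
Qed.

Let pt_itv (a : R) n : 0 < a < 1 -> 0 < pt a n < 1.
Proof. by move=> /(pt_gap n); lra. Qed.

Let pt_lt (a b : R) n : 0 < a -> a < b -> pt a n < pt b n.
Proof.
move=> a0 ab; have n0 : 0 < n.+2%:R :> R by rewrite ltr0n.
by rewrite /pt ltrD2l ltrN2 ltf_pV2 ?posrE; lra.
Qed.

Let pt_ltS (a b : R) n : 0 < a -> 0 < b < 1 -> pt b n < pt a n.+1.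
Proof.
move=> a0 /andP[b0 b1]; have n0 : 0 < n.+2%:R :> R by rewrite ltr0n.
have nS : n.+3%:R = n.+2%:R + 1 :> R by rewrite -natr1.
by rewrite /pt nS ltrD2l ltrN2 ltf_pV2 ?posrE; lra.
Qed.

Let cvg_pt (a : R) : 0 < a -> pt a @ \oo --> (1 : R).
Proof.
move=> a0; rewrite -[X in _ --> X]subr0; apply: cvgB; first exact: cvg_cst.
apply: (@squeeze_cvgr _ _ _ _ (cst 0) (@harmonic R)).
- apply: nearW => n; have n0 : 0 < n.+1%:R :> R by rewrite ltr0n.
  have nS : n.+2%:R = n.+1%:R + 1 :> R by rewrite -natr1.
  by rewrite invr_ge0 /harmonic/= nS lef_pV2 ?posrE; lra.
- exact: cvg_cst.
- exact: cvg_harmonic.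
Qed.

Let phase_pt (a : R) n : 0 < a -> pi / (1 - pt a n) = a * pi + pi *+ n.+2.
Proof.
by move=> a0; rewrite /pt opprB addrC subrK invrK -[pi *+ _]mulr_natl; ring.
Qed.

(** Shifting the phase by a multiple of pi flips both signs or none, so the
    quadratic monomials only depend on [a]. *)
Let sin_cos_pt (a : R) n : 0 < a ->
  [/\ S (pt a n) ^+ 2 = sin (a * pi) ^+ 2, C (pt a n) ^+ 2 = cos (a * pi) ^+ 2 &
     S (pt a n) * C (pt a n) = sin (a * pi) * cos (a * pi)].
Proof.
move=> a0; rewrite /S /C phase_pt//.
rewrite (alternatingn (@sinDpi R)) (alternatingn (@cosDpi R)).
move: n.+2 => m; split; [by rewrite exprMn sqrr_sign mul1r..|].
by rewrite mulrACA -expr2 sqrr_sign mul1r.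
Qed.

Let sin_cos_pi4 : [/\ sin (pi / 4) ^+ 2 = 1 / 2 :> R,
  cos (pi / 4) ^+ 2 = 1 / 2 :> R & sin (pi / 4) * cos (pi / 4) = 1 / 2 :> R].
Proof.
have e : pi / 4 + pi / 4 = pi / 2 :> R by lra.
have := cos2Dsin2 (pi / 4 : R).
have := cosD (pi / 4 : R) (pi / 4); rewrite e cos_pihalf.
have := sinD (pi / 4 : R) (pi / 4); rewrite e sin_pihalf => h1 h2 h3.
by split; lra.
Qed.

Let sin_cos_quarter n : [/\ S (pt (1 / 4) n) ^+ 2 = 1 / 2,
  C (pt (1 / 4) n) ^+ 2 = 1 / 2 & S (pt (1 / 4) n) * C (pt (1 / 4) n) = 1 / 2].
Proof.
have [|-> -> ->] := @sin_cos_pt (1 / 4) n; first by lra.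
by have -> : 1 / 4 * pi = pi / 4 :> R by lra.
Qed.

Let sin_cos_half n : [/\ S (pt (1 / 2) n) ^+ 2 = 1,
  C (pt (1 / 2) n) ^+ 2 = 0 & S (pt (1 / 2) n) * C (pt (1 / 2) n) = 0].
Proof.
have [|-> -> ->] := @sin_cos_pt (1 / 2) n; first by lra.
have -> : 1 / 2 * pi = pi / 2 :> R by lra.
by rewrite sin_pihalf cos_pihalf expr1n expr0n mulr0.
Qed.

Let sin_cos_three_quarters n : [/\ S (pt (3 / 4) n) ^+ 2 = 1 / 2,
  C (pt (3 / 4) n) ^+ 2 = 1 / 2 &
  S (pt (3 / 4) n) * C (pt (3 / 4) n) = - (1 / 2)].
Proof.
have [|-> -> ->] := @sin_cos_pt (3 / 4) n; first by lra.
have -> : 3 / 4 * pi = pi / 4 + pi / 2 :> R by lra.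
rewrite sinDpihalf cosDpihalf sqrrN mulrN [cos _ * _]mulrC.
by have [-> -> ->] := sin_cos_pi4.
Qed.

Let k1E x : k1 x = (1 - x) ^+ 3 *
  (4 * pi * (S x ^+ 2 * (S x * C x)) - 5 * (1 - x) * (S x ^+ 2) ^+ 2).
Proof. by rewrite /k1; ring. Qed.

Let k2E x : k2 x = (1 - x) * (20 * (1 - x) ^+ 2 * (S x ^+ 2) ^+ 2 -
  32 * pi * (1 - x) * (S x ^+ 2 * (S x * C x)) +
  4 * pi ^+ 2 * (3 * S x ^+ 2 * C x ^+ 2 - (S x ^+ 2) ^+ 2)).
Proof. by rewrite /k2; ring. Qed.

(** For small s = 1 - x the sign of [k1] is that of S^3 C and the sign of [k2]
    is that of 3 S^2 C^2 - S^4, except that at phase 3 pi / 4 the middle term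
    of [k2] is positive as well. *)
Let k1_quarter n : 0 < k1 (pt (1 / 4) n).
Proof.
rewrite k1E; have [-> _ ->] := sin_cos_quarter n.
have /andP[s0 s1] : 0 < 1 - pt (1 / 4) n <= 1 / 2 by apply: pt_gap; lra.
rewrite mulr_gt0 ?exprn_gt0//; have := pi_ge2 R; lra.
Qed.

Let k1_three_quarters n : k1 (pt (3 / 4) n) < 0.
Proof.
rewrite k1E; have [-> _ ->] := sin_cos_three_quarters n.
have /andP[s0 s1] : 0 < 1 - pt (3 / 4) n <= 1 / 2 by apply: pt_gap; lra.
rewrite nmulr_llt0 ?exprn_gt0//; have := pi_ge2 R; lra.
Qed.

Let k2_half n : k2 (pt (1 / 2) n) < 0.
Proof.
rewrite k2E; have [-> -> ->] := sin_cos_half n.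
have /andP[] : 0 < 1 - pt (1 / 2) n <= 1 / 2 by apply: pt_gap; lra.
set s := 1 - _ => s0 s1; have p2 := pi_ge2 R.
rewrite pmulr_rlt0//; nra.
Qed.

Let k2_three_quarters n : 0 < k2 (pt (3 / 4) n).
Proof.
rewrite k2E; have [-> -> ->] := sin_cos_three_quarters n.
have /andP[] : 0 < 1 - pt (3 / 4) n <= 1 / 2 by apply: pt_gap; lra.
set s := 1 - _ => s0 s1; have p2 := pi_ge2 R.
rewrite mulr_gt0//; nra.
Qed.

Lemma continuous_pair :
  exists (mu_f mu_g : probability (measurableTypeR R) R) (f g : R -> R),
    (carried_by mu_f `[0, 1] /\ carried_by mu_g `[0, 1]) /\
    is_density mu_f f /\ is_density mu_g g /\
    tail_le mu_f mu_g /\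
    alternate mu_f mu_g f g /\
    alternate mu_f mu_g (law_cdf mu_f) (law_cdf mu_g) /\
    [/\ continuous f & continuous g].
Proof.
have S0 : S 0 = 0 by rewrite /S subr0 divr1 sinpi.
have half01 : 0 < (1 / 2 : R) < 1 by lra.
have quarter01 : 0 < (1 / 4 : R) < 1 by lra.
have three01 : 0 < (3 / 4 : R) < 1 by lra.
have k0_ge0 x : 0 <= x <= 1 -> 0 <= k0 x.
  move=> /andP[_ x1]; apply: mulr_ge0; last by rewrite exprn_even_ge0.
  by rewrite exprn_ge0// subr_ge0.
have dk0 x : 0 < x < 1 -> is_derive x 1 k0 (k1 x).
  by move=> /andP[_ /is_derive_k0].
have dk1 x : 0 < x < 1 -> is_derive x 1 k1 (k2 x).
  by move=> /andP[_ /is_derive_k1].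
have k00 : k0 0 = 0 by rewrite /k0 S0 expr0n mulr0.
have k01 : k0 1 = 0 by rewrite /k0 subrr expr0n mul0r.
have k10 : k1 0 = 0 by rewrite k1E S0 !expr0n /=; ring.
have k11 : k1 1 = 0 by rewrite k1E subrr expr0n mul0r.
have k20 : k2 0 = 0 by rewrite k2E S0 !expr0n /=; ring.
have k21 : k2 1 = 0 by rewrite k2E subrr mul0r.
have [mu_f [mu_g [f [g [c]]]]] := second_derivative_density_pair
  continuous_k0 continuous_k1 continuous_k2 dk0 dk1 k0_ge0 k00 k01 k10 k11 k20 k21
  (pt_itv 0 half01) (k2_half 0).
move=> [[df dg cf cg] [[f01 g01 fg] [c0 fgE FGE]]].
exists mu_f, mu_g, f, g; split; first by [].
do 3 split => //.
have ub : ubound (measure_support mu_f `|` measure_support mu_g) 1.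
  have ub01 : ubound (`[0, 1]%classic : set R) 1.
    by move=> x /=; rewrite in_itv/= => /andP[].
  move=> x []; first exact: ubound_measure_support f01 ub01 x.
  exact: ubound_measure_support g01 ub01 x.
have gf_half n : g (pt (1 / 2) n) < f (pt (1 / 2) n).
  by rewrite -subr_lt0 fgE ?pt_itv// pmulr_rlt0.
have sup1 : measure_support mu_f 1.
  move=> U oU U1; have [mf f0 muE] := df; have [_ g0 _] := dg.
  have [N _ UN] := @cvg_pt (1 / 2) ltac:(lra) U (open_nbhs_nbhs (conj oU U1)).
  have fN := le_lt_trans (g0 _) (gf_half N).
  have := continuous_integral_gt0 cf f0 oU (UN N (leqnn N)) fN.
  by rewrite -muE//; exact: open_measurable.
split.
  apply: (alternate_interlaced sup1 ub (p := pt (1 / 2)) (q := pt (3 / 4))) => //.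
  - by move=> n; apply: pt_lt; lra.
  - by move=> n; apply: pt_ltS; lra.
  - by apply: cvg_pt; lra.
  - by apply: cvg_pt; lra.
  - by move=> n; rewrite -subr_gt0 fgE ?pt_itv// mulr_gt0.
split => //.
apply: (alternate_interlaced sup1 ub (p := pt (3 / 4))
  (q := fun n => pt (1 / 4) n.+1)).
- by move=> n; apply: pt_ltS; lra.
- by move=> n; apply: pt_lt; lra.
- by apply: cvg_pt; lra.
- by rewrite cvg_shiftS; apply: cvg_pt; lra.
- by move=> n; rewrite -subr_lt0 FGE ?pt_itv// pmulr_rlt0.
- by move=> n; rewrite -subr_gt0 FGE ?pt_itv// mulr_gt0.
Qed.

End oscillation.

(** * Pairs with ordered moments and alternating functions *)

Theorem theorem13 (R : realType) :
  (exists (mu_f mu_g : probability (measurableTypeR R) R) (S : set R),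
    [/\ S `<=` `[0, +oo[, bounded_set S & (S #= [set: nat])%card] /\
    carried_by mu_f S /\ carried_by mu_g S /\
    tail_le mu_f mu_g /\
    alternate mu_f mu_g (law_pmf mu_f) (law_pmf mu_g) /\
    alternate mu_f mu_g (law_cdf mu_f) (law_cdf mu_g))
  /\
  (exists (mu_f mu_g : probability (measurableTypeR R) R) (f g : R -> R) (K : set R),
    [/\ K `<=` `[0, +oo[ & compact K] /\
    carried_by mu_f K /\ carried_by mu_g K /\
    [/\ mu_f `<< lebesgue_measure & mu_g `<< lebesgue_measure] /\
    is_density mu_f f /\ is_density mu_g g /\
    tail_le mu_f mu_g /\
    alternate mu_f mu_g f g /\
    alternate mu_f mu_g (law_cdf mu_f) (law_cdf mu_g) /\
    [/\ continuous f & continuous g]).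
Proof.
split.
  exists (@mid_mixture R), (@spread_mixture R), (@atoms R).
  split; last first.
    split; first exact: carried_mid.
    split; first exact: carried_spread.
    split; first exact: tail_le_mid_spread.
    by split; [exact: alternate_pmf_discrete|exact: alternate_cdf_discrete].
  split; last exact: card_atoms.
  - by move=> x /atoms_ge0_lt1/andP[x0 _]; rewrite /= in_itv/= x0.
  - exists 1; split; first exact: num_real.
    move=> M M1 x /atoms_ge0_lt1/andP[x0 x1].
    by rewrite /= ger0_norm// ltW// (lt_trans x1).
have [mu_f [mu_g [f [g [[f01 g01] [df [dg rest]]]]]]] := @continuous_pair R.
exists mu_f, mu_g, f, g, `[0, 1]%classic.
split.
  split; last exact: segment_compact.
  by move=> x /=; rewrite !in_itv/= => /andP[->].
do 2 (split; first by []).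
split.
  by split; [exact: is_density_dominates df|exact: is_density_dominates dg].
by do 2 (split; first by []).
Qed.
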